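(* Let $n\ge 2$ be an integer, let $\mathcal{Q}_{4n}$ be the dicyclic group of order $4n$, and let $\rho_1(\mathcal{P}(\mathcal{Q}_{4n}))$ be the distance spectral radius of its power graph. Let $T_{avg}$ and $T_{max}$ be, respectively, the average and the maximum transmission of the power graph $\mathcal{P}(C_{2n})$ of the cyclic group $C_{2n}$ of order $2n$. Then $$\rho_{1}(\mathcal{P}(\mathcal{Q}_{4n})) \ge \frac{1}{2}\left[(T_{avg}+4n-3) + \sqrt{(T_{avg}-4n+3)^{2}+16(2n-1)^{2}}\right]$$ and $$\rho_{1}(\mathcal{P}(\mathcal{Q}_{4n}))\le \frac{1}{2}\left[(T_{max}+4n-3) + \sqrt{(T_{max}-4n+3)^{2}+32n(2n-1)}\right].$$
   Context: The power graph $\mathcal{P}(\mathbb{G})$ of a finite group $\mathbb{G}$ is the simple undirected graph with vertex set $\mathbb{G}$ in which two distinct elements $x,y$ are adjacent if and only if one of them is an integral power of the other; it is always connected. The dicyclic group is $\mathcal{Q}_{4n}=\langle a,b \mid a^{2n}=e,\ a^n=b^2,\ ab=ba^{-1}\rangle$, of order $4n$. For a connected graph $G$ with vertices $v_1,\dots,v_N$, the distance matrix is $D(G)=(d_{ij})$ with $d_{ij}$ the length of a shortest path between $v_i$ and $v_j$; the distance spectral radius $\rho_1(G)$ is the largest eigenvalue of $D(G)$; the transmission of $v_i$ is $\operatorname{Tr}(v_i)=\sum_{j=1}^N d_{ij}$; the average and maximum transmissions of $G$ are the mean and the maximum of $\operatorname{Tr}(v_i)$ over all vertices of $G$. *)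

(* Defs.v *)
From HB Require Import structures.
From mathcomp Require Import all_boot all_order all_algebra all_fingroup.
From mathcomp Require Import all_solvable.
From mathcomp Require Import boolp classical_sets reals.

Set Implicit Arguments.
Unset Strict Implicit.
Unset Printing Implicit Defensive.

Import Order.TTheory GRing.Theory Num.Theory.
Local Open Scope ring_scope.

(* A simple graph is given by its vertex set T, a finite type, and its
   adjacency relation e : rel T. *)
Section Graph.

Variables (T : finType) (e : rel T).

(* Two vertices x and y of a connected graph are joined by a walk with fewer
   than #|T| edges, so the search succeeds and returns the least length of a
   walk from x to y. Without such a walk the value is #|T|. *)
Definition graph_dist (x y : T) : nat :=
  find (fun k => [exists p : k.-tuple T, path e x p && (last x p == y)])
       (iota 0 #|T|).

Definition transmission (x : T) : nat := (\sum_(y : T) graph_dist x y)%N.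

Definition max_transmission : nat := (\max_(x : T) transmission x)%N.

Variable R : realType.

Definition avg_transmission : R :=
  (\sum_(x : T) (transmission x)%:R) / #|T|%:R.

Definition distance_matrix : 'M[R]_#|T| :=
  \matrix_(i < #|T|, j < #|T|) (graph_dist (enum_val i) (enum_val j))%:R.

(* The largest eigenvalue, by definite description: [xget 0 P] is an element
   satisfying P, or 0 if there is none. At most one real satisfies the
   predicate; for a nonempty graph with e symmetric one does, since the
   distance matrix is then real symmetric. *)
Definition distance_spectral_radius : R :=
  xget 0 [set rho : R | eigenvalue distance_matrix rho /\
              forall mu : R, eigenvalue distance_matrix mu -> mu <= rho]%classic.

End Graph.

(* In a finite group, the integral powers of y are the elements of <[y]>. *)
Definition power_graph (gT : finGroupType) : rel gT :=
  fun x y => (x != y) && ((x \in <[y]>%g) || (y \in <[x]>%g)).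

(* [\isog Grp] characterizes the largest finite quotient of the presented
   group; that group is itself finite, of order 4n. *)
Definition dicyclic (n : nat) (gT : finGroupType) : Prop :=
  ([set: gT]%SET \isog
    Grp (a : b : a ^+ (2 * n)%N, a ^+ n = b ^+ 2, a * b = b * a^-1))%g.

(* Main.v *)
Require Import Defs.
From HB Require Import structures.
From mathcomp Require Import all_boot all_order all_algebra all_fingroup.
From mathcomp Require Import all_solvable.
From mathcomp Require Import boolp classical_sets reals.
From mathcomp Require Import complex ring lra zify.

(** Let A = <a> be the cyclic subgroup of index 2 of the dicyclic group Q and
    z = a ^+ n its involution. An element x outside A satisfies x ^+ 2 = z, so
    that <[x]> = {1, x, z, x * z}. The identity is adjacent to every other
    vertex of a power graph, hence all distances are 0, 1 or 2, and the
    neighbours of x are 1, z and x * z. Relative to the partition of Q into A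
    and its complement (2n elements each), the row sums of the distance matrix
    in the four blocks are as follows:
    - from A to A they are the transmissions of the power graph of C_2n, since
      A is isomorphic to C_2n and a power graph depends only on the cyclic
      subgroups;
    - from the complement to A they are 2 * 2n - 2 = 4n - 2, and inside the
      complement they are 2 * 2n - 3 = 4n - 3;
    - from A to the complement they are at most 2 * 2n = 4n, with mean 4n - 2
      by symmetry of the matrix.

    Both bounds come from vectors that are constant on the two blocks. Such a
    vector turns the distance matrix into a 2 x 2 quotient matrix with rows
    (t, r) and (s, q), whose larger eigenvalue lam is the larger root of
    (lam - t) * (lam - q) = r * s; the two bounds are such roots with
    q = 4n - 3.
    For the lower bound, t is the average transmission and r = s = 4n - 2; the
    Rayleigh quotient of the vector built from the lam-eigenvector of the
    quotient is lam, and a real symmetric matrix has an eigenvalue at least as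
    large as each of its Rayleigh quotients
    ([symmetric_max_eigenvalue], [two_block_lower_bound]).
    For the upper bound, t is the maximum transmission, r = 4n and s = 4n - 2;
    the lam-eigenvector of the quotient gives a positive vector w with
    D w <= lam w entrywise, which bounds every eigenvalue of the nonnegative
    matrix D ([eigenvalue_le_test_vector], [two_block_upper_bound]).

    That #[a] = 2n and #|Q| = 4n does not follow from the relations alone: the
    relations bound the order of Q by 4n, and equality needs a group of order
    4n in which they hold ([dicyclic_model]), as this group is then a
    homomorphic image of Q. *)

Set Implicit Arguments.
Unset Strict Implicit.
Unset Printing Implicit Defensive.

Import Order.TTheory GRing.Theory Num.Theory.
Local Open Scope ring_scope.

(** * Eigenvalues of real symmetric matrices *)

Section Spectral.
Local Open Scope sesquilinear_scope.

(** The spectral theorem is applied to M over R[i]. M is Hermitian there, so its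
    diagonal form D has real entries, which are eigenvalues of M over R; in the
    orthonormal eigenbasis the quadratic form of M is a combination of these
    entries with nonnegative weights, at most their maximum times the squared
    norm. Maximality among all eigenvalues follows by evaluating the form at an
    eigenvector. *)
Lemma symmetric_max_eigenvalue (R : rcfType) n (M : 'M[R]_n) :
    M^T = M -> (0 < n)%N ->
  exists rho, [/\ eigenvalue M rho,
      forall mu, eigenvalue M mu -> mu <= rho &
      forall v : 'rV_n, (v *m M *m v^T) 0 0 <= rho * (v *m v^T) 0 0].
Proof.
move=> Msym n_gt0; pose toC := real_complex R.
pose A := map_mx toC M; pose P := spectralmx A; pose D := spectral_diag A.
have Ah : A \is hermsymmx.
  apply: realsym_hermsym; last first.
    by apply/mxOverP=> i j; rewrite mxE; apply/complex_realP; exists (M i j).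
  by apply/is_hermitianmxP; rewrite expr0 scale1r map_mx_id // /A map_trmx Msym.
have AE : A = invmx P *m diag_mx D *m P.
  exact/orthomx_spectralP/hermitian_normalmx.
have PU : P \is unitarymx := spectral_unitarymx A.
have Pu : P \in unitmx := spectral_unit A.
have DR i : {r | D 0 i = toC r}.
  apply/cid/complex_realP.
  by have /mxOverP := hermitian_spectral_diag_real Ah; apply.
pose d i := sval (DR i).
have dE i : D 0 i = toC (d i) := svalP (DR i).
have d_eig i : eigenvalue M (d i).
  rewrite -(eigenvalue_map toC) -/A; apply/eigenvalueP; exists (row i P).
    rewrite -row_mul AE !mulmxA mulmxV // mul1mx row_mul.
    rewrite (_ : row i (diag_mx D) = D 0 i *: delta_mx 0 i); last first.
      by apply/rowP=> j; rewrite !mxE eqxx /= eq_sym mulr_natr.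
    by rewrite -scalemxAl -rowE dE.
  apply/eqP=> Pi0; have /rowP/(_ i) := congr1 (row i) (mulmxV Pu).
  by rewrite row_mul Pi0 mul0mx !mxE eqxx => /esym/eqP; rewrite oner_eq0.
pose m := [arg max_(i > Ordinal n_gt0) d i]%O.
have le_dm i : d i <= d m by rewrite /m; case: arg_maxP => // j _; apply.
have rayleigh (v : 'rV_n) : (v *m M *m v^T) 0 0 <= d m * (v *m v^T) 0 0.
  (* y holds the coordinates of v in the orthonormal eigenbasis *)
  pose u := map_mx toC v; pose y := u *m P^t*.
  have uE : u = y *m P by rewrite mulmxKtV.
  have uT : u^t* = map_mx toC v^T.
    apply/matrixP=> i j; rewrite !mxE.
    by apply/CrealP/complex_realP; exists (v j i).
  have yT : P *m u^t* = y^t* by rewrite /y trmx_mul map_mxM trmxCK.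
  have normE : toC ((v *m v^T) 0 0) = \sum_i y 0 i * (y 0 i)^*.
    have -> : toC ((v *m v^T) 0 0) = (u *m u^t*) 0 0.
      by rewrite uT -map_mxM [RHS]mxE.
    by rewrite {1}uE -mulmxA yT mxE; apply: eq_bigr => i _; rewrite !mxE.
  have quadE : toC ((v *m M *m v^T) 0 0) = \sum_i D 0 i * (y 0 i * (y 0 i)^*).
    have -> : toC ((v *m M *m v^T) 0 0) = (u *m A *m u^t*) 0 0.
      by rewrite uT -!map_mxM [RHS]mxE.
    rewrite AE invmx_unitary // !mulmxA -/y -mulmxA yT mul_mx_diag mxE.
    by apply: eq_bigr => i _; rewrite !mxE; ring.
  suff: toC ((v *m M *m v^T) 0 0) <= toC (d m) * toC ((v *m v^T) 0 0).
    by rewrite -rmorphM lecR.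
  rewrite normE quadE mulr_sumr.
  apply: ler_sum => i _; apply: ler_wpM2r; first exact: mul_conjC_ge0.
  by rewrite dE lecR.
exists (d m); split=> // mu /eigenvalueP[v vM v_neq0].
have vv_gt0 : 0 < (v *m v^T) 0 0.
  have [i vi] : exists i, v 0 i != 0 by apply/rV0Pn.
  rewrite mxE (bigD1 i) //= mxE ltr_wpDr //.
    by apply: sumr_ge0 => j _; rewrite mxE -expr2 sqr_ge0.
  by rewrite -expr2 lt_def sqrf_eq0 vi sqr_ge0.
by have := rayleigh v; rewrite vM -scalemxAl mxE ler_pM2r.
Qed.
End Spectral.

(** The Collatz-Wielandt bound, by duality: if v is a left eigenvector for mu
    then `|mu| `|v| <= `|v| M entrywise, and pairing with w gives
    `|mu| (`|v| w) <= `|v| (M w) <= lam (`|v| w), where `|v| w > 0. *)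
Lemma eigenvalue_le_test_vector (R : realFieldType) n (M : 'M[R]_n)
    (w : 'cV[R]_n) lam mu :
    (forall i j, 0 <= M i j) -> (forall i, 0 < w i 0) ->
    (forall i, (M *m w) i 0 <= lam * w i 0) -> eigenvalue M mu -> mu <= lam.
Proof.
move=> M_ge0 w_gt0 Mw /eigenvalueP[v vM v_neq0].
pose S := \sum_i `|v 0 i| * w i 0.
have S_gt0 : 0 < S.
  have [i vi] : exists i, v 0 i != 0 by apply/rV0Pn.
  rewrite /S (bigD1 i) //= ltr_wpDr ?mulr_gt0 ?normr_gt0 //.
  by apply: sumr_ge0 => j _; rewrite mulr_ge0 // ltW.
rewrite -(ler_pM2r S_gt0) (le_trans (ler_wpM2r (ltW S_gt0) (ler_norm mu))) //.
have step j : `|mu| * (`|v 0 j| * w j 0) <= \sum_i `|v 0 i| * M i j * w j 0.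
  rewrite mulrA -mulr_suml ler_wpM2r ?(ltW (w_gt0 j)) // -normrM.
  have -> : mu * v 0 j = \sum_i v 0 i * M i j.
    by have /rowP/(_ j) := vM; rewrite !mxE => <-.
  rewrite (le_trans (ler_norm_sum _ _ _)) //; apply: ler_sum => i _.
  by rewrite normrM (ger0_norm (M_ge0 i j)).
rewrite /S mulr_sumr (le_trans (ler_sum _ (fun j _ => step j))) //.
rewrite exchange_big mulr_sumr; apply: ler_sum => i _.
under eq_bigr do rewrite -mulrA.
by rewrite -mulr_sumr mulrCA ler_wpM2l //; have := Mw i; rewrite mxE.
Qed.

(** The number lam is the larger eigenvalue of a 2 x 2 matrix with diagonal
    entries T and q whose off-diagonal entries have product p. *)
Lemma larger_quadratic_root (R : rcfType) (T q p : R) : 0 < p ->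
  let lam := 2^-1 * ((T + q) + Num.sqrt ((T - q) ^+ 2 + 4 * p)) in
  T < lam /\ (lam - T) * (lam - q) = p.
Proof.
move=> p_gt0; set s := Num.sqrt _ => lam.
have disc_ge0 : 0 <= (T - q) ^+ 2 + 4 * p by have := sqr_ge0 (T - q); lra.
have ss : s ^+ 2 = (T - q) ^+ 2 + 4 * p by rewrite sqr_sqrtr.
have lt_Tq : T - q < s.
  apply: le_lt_trans (ler_norm _) _.
  by rewrite -sqrtr_sqr ltr_sqrt; have := sqr_ge0 (T - q); lra.
split; first by rewrite /lam; lra.
transitivity ((s ^+ 2 - (T - q) ^+ 2) / 4); first by rewrite /lam; field.
by rewrite ss; field.
Qed.

(** * Distances and the distance spectral radius of a graph *)

(** Two nonadjacent vertices are joined by a walk of length 2 through c. The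
    bound on #|T| ensures that length 2 lies in the range of the search. *)
Lemma graph_dist_universal (T : finType) (e : rel T) (c : T) :
    (forall y, y != c -> e c y && e y c) -> (2 < #|T|)%N ->
  forall x y,
    graph_dist e x y = if x == y then 0%N else if e x y then 1%N else 2%N.
Proof.
move=> ec T_gt2 x y; rewrite /graph_dist.
case: #|T| T_gt2 => [|[|[|k]]] //= _.
have -> : [exists p : 0.-tuple T, path e x p && (last x p == y)] = (x == y).
  apply/existsP/idP => [[p]|xy]; last by exists [tuple].
  by rewrite (tuple0 p).
have -> : [exists p : 1.-tuple T, path e x p && (last x p == y)] = e x y.
  apply/existsP/idP => [[p]|xy]; last by exists [tuple y]; rewrite /= xy eqxx.
  by case: (tupleP p) => z q; rewrite (tuple0 q) /= andbT => /andP[? /eqP <-].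
case: eqVneq => [//|xy]; case: ifP => // exy.
suff -> : [exists p : 2.-tuple T, path e x p && (last x p == y)] by [].
have xc : x != c.
  apply: contraFneq exy => xc; rewrite xc in xy *.
  by have /andP[] : e c y && e y c by apply: ec; rewrite eq_sym.
have yc : y != c.
  apply: contraFneq exy => yc; rewrite yc in xy *.
  by have /andP[] := ec x xy.
apply/existsP; exists [tuple c; y]; rewrite /= eqxx !andbT.
by have /andP[_ ->] := ec x xc; have /andP[->] := ec y yc.
Qed.

Section Radius.
Variables (R : realType) (T : finType) (e : rel T).
Hypothesis dist_sym : forall x y, graph_dist e x y = graph_dist e y x.
Hypothesis T_gt0 : (0 < #|T|)%N.

Local Notation d x y := ((graph_dist e x y)%:R : R).
Local Notation rho := (distance_spectral_radius e R).

Let sum_enum (F : T -> R) : \sum_(i < #|T|) F (enum_val i) = \sum_x F x.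
Proof. by rewrite -(big_enum_val F); apply: eq_bigl. Qed.

(** Symmetry of the distances gives a largest eigenvalue, so that the default
    value of [xget] is not taken. *)
Let radiusP : [/\ eigenvalue (distance_matrix e R) rho &
  forall v : 'rV_#|T|,
    (v *m distance_matrix e R *m v^T) 0 0 <= rho * (v *m v^T) 0 0].
Proof.
have Dsym : (distance_matrix e R)^T = distance_matrix e R.
  by apply/matrixP=> i j; rewrite !mxE dist_sym.
have [r [rE r_max r_ray]] := symmetric_max_eigenvalue Dsym T_gt0.
have [rhoE rho_max] : [set rho : R | eigenvalue (distance_matrix e R) rho /\
    forall mu : R, eigenvalue (distance_matrix e R) mu -> mu <= rho]%classic
    rho.
  by apply: xgetPex; exists r.
split=> // v; suff -> : rho = r by [].
by apply/le_anti; rewrite rho_max // r_max.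
Qed.

Lemma rayleigh_le_spectral_radius (v : T -> R) :
  \sum_x \sum_y v x * d x y * v y <= rho * \sum_x v x ^+ 2.
Proof.
have [_ /(_ (\row_i v (enum_val i)))] := radiusP.
rewrite !mxE -(sum_enum (fun x => v x ^+ 2)).
congr (_ <= rho * _); last by apply: eq_bigr => i _; rewrite !mxE expr2.
rewrite exchange_big -sum_enum; apply: eq_bigr => j _.
rewrite !mxE mulr_suml -sum_enum; apply: eq_bigr => i _.
by rewrite !mxE.
Qed.

Lemma spectral_radius_le_test_vector (w : T -> R) lam :
    (forall x, 0 < w x) -> (forall x, \sum_y d x y * w y <= lam * w x) ->
  rho <= lam.
Proof.
move=> w_gt0 dw; have [rhoE _] := radiusP.
apply: (eigenvalue_le_test_vector (w := \col_i w (enum_val i))) rhoE.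
- by move=> i j; rewrite mxE ler0n.
- by move=> i; rewrite mxE.
move=> i; rewrite !mxE.
apply: le_trans (dw (enum_val i)); rewrite -sum_enum.
by apply/ler_sum => j _; rewrite !mxE.
Qed.
End Radius.

(** * Quotient bounds for a partition into two blocks *)

Section TwoBlocks.
Variables (R : realType) (T : finType) (e : rel T) (A : {set T}).
Hypothesis dist_sym : forall x y, graph_dist e x y = graph_dist e y x.
Hypothesis T_gt0 : (0 < #|T|)%N.

Local Notation d x y := ((graph_dist e x y)%:R : R).
Local Notation rho := (distance_spectral_radius e R).

Let step (u v : R) x := if x \in A then u else v.

Let sum_step (F : T -> R) u v :
  \sum_y F y * step u v y =
  u * (\sum_(y in A) F y) + v * (\sum_(y in ~: A) F y).
Proof.
rewrite (bigID (mem A)) /= !mulr_sumr; congr (_ + _).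
  by apply: eq_bigr => y Ay; rewrite /step Ay mulrC.
by apply: eq_big => [y|y nAy]; rewrite ?inE // /step (negPf nAy) mulrC.
Qed.

(** The vector (s, lam - t) is the lam-eigenvector of the symmetric quotient
    matrix with rows (t, s) and (s, q); as the two blocks have the same size N,
    its Rayleigh quotient for the full matrix is lam. *)
Lemma two_block_lower_bound (N : nat) (t q s : R) :
    #|A| = N -> #|~: A| = N -> (0 < N)%N -> 0 < s ->
    \sum_(x in A) \sum_(y in A) d x y = N%:R * t ->
    \sum_(x in ~: A) \sum_(y in A) d x y = N%:R * s ->
    \sum_(x in ~: A) \sum_(y in ~: A) d x y = N%:R * q ->
  2^-1 * (t + q + Num.sqrt ((t - q) ^+ 2 + 4 * s ^+ 2)) <= rho.
Proof.
move=> cardA cardB N_gt0 s_gt0 sumAA sumBA sumBB.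
set lam := leLHS.
have [lt_t lamE] : t < lam /\ (lam - t) * (lam - q) = s ^+ 2.
  exact/larger_quadratic_root/exprn_gt0.
have sumAB : \sum_(x in A) \sum_(y in ~: A) d x y = N%:R * s.
  rewrite -sumBA exchange_big; apply: eq_bigr => y _; apply: eq_bigr => x _.
  by rewrite dist_sym.
have := rayleigh_le_spectral_radius dist_sym T_gt0 (step s (lam - t)).
under eq_bigr => x _.
  under eq_bigr do rewrite -mulrA.
  rewrite -mulr_sumr sum_step mulrC.
  over.
rewrite sum_step !big_split /= -!mulr_sumr sumAA sumAB sumBA sumBB.
rewrite sum_step.
have -> : \sum_(x in A) step s (lam - t) x = N%:R * s.
  rewrite (eq_bigr (fun=> s)) => [|x Ax]; last by rewrite /step Ax.
  by rewrite sumr_const cardA mulr_natl.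
have -> : \sum_(x in ~: A) step s (lam - t) x = N%:R * (lam - t).
  rewrite (eq_bigr (fun=> lam - t)) => [|x].
    by rewrite sumr_const cardB mulr_natl.
  by rewrite inE /step => /negPf->.
set S := N%:R * (s ^+ 2 + (lam - t) ^+ 2).
have S_gt0 : 0 < S.
  by rewrite mulr_gt0 ?ltr0n // addr_gt0 // exprn_gt0 // subr_gt0.
move=> ray; rewrite -(ler_pM2r S_gt0).
have -> : rho * S = rho * (s * (N%:R * s) + (lam - t) * (N%:R * (lam - t))).
  by rewrite /S; ring.
apply: le_trans ray; rewrite le_eqVlt; apply/orP; left; apply/eqP; rewrite /S.
apply/esym.
(* the added last summand vanishes by the equation for lam *)
transitivity (N%:R * (s ^+ 2 * t + 2 * s ^+ 2 * (lam - t) + (lam - t) ^+ 2 * q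
  + (lam - t) * ((lam - t) * (lam - q) - s ^+ 2))).
  by rewrite lamE; ring.
by ring.
Qed.

(** The vector (r, lam - t) is the lam-eigenvector of the quotient matrix with
    rows (t, r) and (s, q), and it is positive since t < lam. *)
Lemma two_block_upper_bound (t q r s : R) :
    0 < r -> 0 < s ->
    (forall x, x \in A -> \sum_(y in A) d x y <= t) ->
    (forall x, x \in A -> \sum_(y in ~: A) d x y <= r) ->
    (forall x, x \notin A -> \sum_(y in A) d x y <= s) ->
    (forall x, x \notin A -> \sum_(y in ~: A) d x y <= q) ->
  rho <= 2^-1 * (t + q + Num.sqrt ((t - q) ^+ 2 + 4 * (r * s))).
Proof.
move=> r_gt0 s_gt0 rAA rAB rBA rBB; set lam := leRHS.
have [lt_t lamE] : t < lam /\ (lam - t) * (lam - q) = r * s.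
  exact/larger_quadratic_root/mulr_gt0.
apply: (spectral_radius_le_test_vector dist_sym T_gt0
  (w := step r (lam - t))).
  by move=> x; rewrite /step; case: ifP => // _; rewrite subr_gt0.
move=> x; rewrite sum_step /step; case: ifPn => Ax.
  have -> : lam * r = r * t + (lam - t) * r by ring.
  by rewrite lerD // ler_wpM2l ?rAA ?rAB // ltW // subr_gt0.
have -> : lam * (lam - t) = r * s + (lam - t) * q by rewrite -lamE; ring.
by rewrite lerD // ler_wpM2l ?rBA ?rBB // ltW // subr_gt0.
Qed.
End TwoBlocks.

(** * The dicyclic group *)

(** The pair (i, s) stands for the normal form a ^+ i * b ^+ s, with n = m.+1.
    Products are computed with b * a ^+ j = a ^- j * b and b ^+ 2 = a ^+ n. *)
Definition dicyclic_model (m : nat) : Type := ('Z_(2 * m.+1) * bool)%type.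

Section DicyclicModel.
Variable m : nat.
Local Notation n := m.+1.
Local Notation Q := (dicyclic_model m).
Implicit Types x y : Q.

HB.instance Definition _ := Finite.on Q.

Let h : 'Z_(2 * n) := n%:R.

Let n2_eq0 : (2 * n)%:R = 0 :> 'Z_(2 * n).
Proof. by rewrite pchar_Zp // mulnS. Qed.

Let hh : h + h = 0.
Proof. by rewrite /h -natrD addnn -mul2n n2_eq0. Qed.

Definition dicyclic_mul x y : Q :=
  (x.1 + (if x.2 then - y.1 else y.1) + (if x.2 && y.2 then n%:R else 0),
   x.2 (+) y.2).
Definition dicyclic_one : Q := (0, false).
Definition dicyclic_inv x : Q := (if x.2 then x.1 + n%:R else - x.1, x.2).

Fact dicyclic_mulA : associative dicyclic_mul.
Proof.
(* only the product of three elements outside <a> uses h = - h *)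
have hN : h = - h by apply/eqP; rewrite -addr_eq0 hh.
move=> [i s] [j t] [k u]; rewrite /dicyclic_mul /= -/h addbA.
by congr (_, _); case: s t u => [] [] [] /=; first rewrite [in LHS]hN; ring.
Qed.

Fact dicyclic_mul1 : left_id dicyclic_one dicyclic_mul.
Proof. by move=> [i s]; rewrite /dicyclic_mul /= add0r addr0. Qed.

Fact dicyclic_mulV : left_inverse dicyclic_one dicyclic_inv dicyclic_mul.
Proof.
move=> [i s]; rewrite /dicyclic_mul /dicyclic_one /= -/h addbb.
by congr (_, _); case: s => /=; [rewrite -[RHS]hh|]; ring.
Qed.

HB.instance Definition _ :=
  Finite_isGroup.Build Q dicyclic_mulA dicyclic_mul1 dicyclic_mulV.

Lemma card_dicyclic_model : #|[set: Q]%SET| = (4 * n)%N.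
Proof. by rewrite cardsT card_prod card_bool card_ord Zp_cast; lia. Qed.

Lemma dicyclic_model_homg :
  ([set: Q]%SET \homg
    Grp (a : b : a ^+ (2 * n)%N, a ^+ n = b ^+ 2, a * b = b * a^-1))%g.
Proof.
pose a : Q := (1, false); pose b : Q := (0, true).
have aX k : (a ^+ k)%g = (k%:R, false) :> Q.
  elim: k => [|k IHk]; first by rewrite expg0.
  by rewrite expgS IHk /mulg/= /dicyclic_mul /= addr0 mulrS.
apply/existsP; exists (a, b); rewrite /= !xpair_eqE /=.
apply/and4P; split.
- rewrite finset.eqEsubset finset.subsetT /=; apply/fintype.subsetP=> -[i s] _.
  have -> : (i, s) = (a ^+ i * b ^+ s)%g :> Q.
    rewrite aX natr_Zp; case: s; last by rewrite expg0 mulg1.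
    by rewrite expg1 /mulg /= /dicyclic_mul /= !addr0.
  by rewrite groupM // groupX // mem_gen // inE cycle_id ?orbT.
- by rewrite aX n2_eq0.
- by rewrite aX expgS expg1 /mulg /= /dicyclic_mul /= oppr0 !add0r.
- by rewrite /mulg /invg /= /dicyclic_mul /= opprK !addr0 add0r.
Qed.

End DicyclicModel.

Section DicyclicStructure.
Local Open Scope group_scope.

(** The relations make <a> normal and put b ^+ 2 into it, so the group is the
    union of <a> and <a> * b and has at most 2 * #[a] <= 4n elements; the model
    is a quotient, which forces equality. For y in <a>, conjugation by b inverts
    y, hence (y * b) ^+ 2 = y * y^-1 * b ^+ 2 = a ^+ n. *)
Lemma dicyclic_structure n (gT : finGroupType) : (0 < n)%N -> dicyclic n gT ->
  exists a : gT, [/\ #[a] = (2 * n)%N, #|gT| = (4 * n)%N &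
    forall x, x \notin <[a]> -> x ^+ 2 = a ^+ n].
Proof.
case: n => [//|m] _ Qdic; set n := m.+1 in Qdic *.
have card_ge : (4 * n <= #|gT|)%N.
  rewrite -card_dicyclic_model -cardsT; apply: leq_homg.
  by rewrite Qdic; apply: dicyclic_model_homg.
have := homg_refl [set: gT]; rewrite Qdic => /existsP[[a b]].
rewrite /= !xpair_eqE /= => /and4P[/eqP defG /eqP a2n /eqP an /eqP ab].
have aJb : a ^ b = a^-1 by rewrite conjgE ab mulKg.
have AJb y : y \in <[a]> -> y ^ b = y^-1.
  by case/cycleP=> k ->; rewrite conjXg aJb expgVn.
have b2A : b ^+ 2 \in <[a]> by rewrite -an mem_cycle.
have nAb : <[b]> \subset 'N(<[a]>).
  by rewrite cycle_subG inE -cycleJ aJb cycleV.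
have split_A x : x \notin <[a]> -> x * b^-1 \in <[a]>.
  have : x \in <[a]> <*> <[b]> by rewrite defG inE.
  rewrite norm_joinEr // => /mulsgP[y _ Ay /cycleP[k ->] ->].
  rewrite -(odd_double_half k) addnC expgD -mul2n expgM.
  have := groupX k./2 b2A; set c := _ ^+ k./2 => Ac.
  case: (odd k) => /=; first by rewrite expg1 mulgA mulgK => _; apply: groupM.
  by rewrite expg0 mulg1 => /negP[]; apply: groupM.
have card_a : (#[a] <= 2 * n)%N.
  by apply: dvdn_leq => //; rewrite order_dvdn a2n.
have card_le : (#|gT| <= #[a] + #[a])%N.
  rewrite -cardsT /order -{2}(card_rcoset <[a]> b).
  apply: leq_trans (leq_card_setU _ _).1.
  apply/subset_leq_card/fintype.subsetP=> x _; rewrite inE mem_rcoset.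
  by case: (boolP (x \in _)) => //=; apply: split_A.
have Ecard : #|gT| = (4 * n)%N.
  by apply/eqP; rewrite eqn_leq card_ge andbT; apply: leq_trans card_le _; lia.
exists a; split=> //; first lia.
move=> x /split_A; set y := x * _ => Ay.
have -> : x = y * b by rewrite mulgKV.
have by_ : b * y = y^-1 * b.
  by rewrite -{1}[y]invgK -(AJb y^-1) ?groupV // conjgE mulKVg.
by rewrite an !expgS expg0 !mulg1 mulgA -[y * b * y]mulgA by_ mulKVg.
Qed.
End DicyclicStructure.

(** * Distances in power graphs *)

Lemma power_graph_dist (gT : finGroupType) (x y : gT) : (2 < #|gT|)%N ->
  graph_dist (@power_graph gT) x y =
    if x == y then 0%N
    else if (x \in <[y]>%g) || (y \in <[x]>%g) then 1%N else 2%N.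
Proof.
move=> gT_gt2; rewrite (graph_dist_universal (c := 1%g)) //.
  by rewrite /power_graph; case: eqVneq.
by move=> z z1; rewrite /power_graph !group1 orbT z1 eq_sym z1.
Qed.

Lemma power_graph_dist_sym (gT : finGroupType) (x y : gT) : (2 < #|gT|)%N ->
  graph_dist (@power_graph gT) x y = graph_dist (@power_graph gT) y x.
Proof. by move=> gT_gt2; rewrite !power_graph_dist // eq_sym orbC. Qed.

(** An injective morphism preserves and reflects membership in cyclic subgroups,
    hence adjacency; the common value of the distances then follows because
    they depend on adjacency only. *)
Lemma power_graph_dist_injm (aT rT : finGroupType)
    (f : {morphism [set: aT]%SET >-> rT}) :
    ('injm f)%g -> (2 < #|aT|)%N ->
  forall x y, graph_dist (@power_graph rT) (f x) (f y) =
              graph_dist (@power_graph aT) x y.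
Proof.
move=> /injmP injf aT_gt2 x y.
have inj_f : injective f by move=> u v; apply: injf; rewrite inE.
have rT_gt2 : (2 < #|rT|)%N := leq_trans aT_gt2 (leq_card f inj_f).
have mem_f u v : (f u \in <[f v]>%g) = (u \in <[v]>%g).
  rewrite -morphim_cycle ?inE //; apply/morphimP/idP => [[w _ wv]|uv].
    by move/inj_f => ->.
  by exists u; rewrite ?inE.
by rewrite !power_graph_dist // (inj_eq inj_f) !mem_f.
Qed.

Section SquareOutside.
Variables (gT : finGroupType) (A : {group gT}) (z : gT).
Local Open Scope group_scope.
Hypothesis Az : z \in A.
Hypothesis z_neq1 : z != 1.
Hypothesis z2 : z ^+ 2 = 1.
Hypothesis sqr_out : forall x, x \notin A -> x ^+ 2 = z.
Hypothesis gT_gt2 : (2 < #|gT|)%N.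

(** As x has order 4 with x ^+ 2 = z, a power of x is determined by the two
    lowest binary digits of the exponent. *)
Let mem_cycle_out x y : x \notin A ->
  (y \in <[x]>) = [|| y == 1, y == z, y == x | y == x * z].
Proof.
move=> /sqr_out x2; apply/idP/idP => [/cycleP[k ->]|].
  rewrite -(odd_double_half k) expgD -mul2n expgM x2.
  rewrite -(odd_double_half k./2) expgD -mul2n expgM z2 expg1n mulg1.
  by case: (odd k) (odd k./2) => [] [];
    rewrite ?expg0 ?expg1 ?mul1g ?mulg1 eqxx ?orbT.
by case/or4P=> /eqP->; rewrite -?x2 ?groupM ?groupX ?cycle_id.
Qed.

Local Notation d := (graph_dist (@power_graph gT)).

(** An element y of A generates a subgroup of A, so adjacency with x means that
    y is a power of x lying in A. *)
Lemma dist_out_in x y : x \notin A -> y \in A ->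
  d x y = if y \in [set 1; z] then 1%N else 2%N.
Proof.
move=> nAx Ay; rewrite power_graph_dist //.
have y_notin u : u \notin A -> (y == u) = false.
  by move=> nAu; apply: contraNF nAu => /eqP <-.
have -> : (x \in <[y]>) = false.
  by apply: contraNF nAx => /cycleP[k ->]; apply: groupX.
rewrite eq_sym (y_notin x nAx) mem_cycle_out // (y_notin x nAx) !inE.
by rewrite (y_notin (x * z)) ?groupMr //= !orbF.
Qed.

Lemma dist_out_out x y : x \notin A -> y \notin A ->
  d x y = if y == x then 0%N else if y == x * z then 1%N else 2%N.
Proof.
move=> nAx nAy; rewrite power_graph_dist // eq_sym.
case: eqVneq => // yx; rewrite !mem_cycle_out // (eq_sym x y) (negPf yx).
have ne u v : u \in A -> v \notin A -> (v == u) = false.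
  by move=> Au; apply: contraNF => /eqP ->.
rewrite !(ne 1) ?group1 // !(ne z) //=.
suff -> : (x == y * z) = (y == x * z) by rewrite orbb.
have zz : z * z = 1 by rewrite -z2.
by apply/eqP/eqP=> ->; rewrite -mulgA zz mulg1.
Qed.

(** Every distance is 2, except for 1 and z, where it drops by 1. *)
Lemma sum_dist_out_in x : x \notin A -> (\sum_(y in A) d x y + 2 = 2 * #|A|)%N.
Proof.
move=> nAx.
rewrite (eq_bigr (fun y => if y \in [set 1; z] then 1%N else 2%N)) => [|y];
  last exact: dist_out_in.
have count : (\sum_(y in A) ((y \in [set 1; z]%g) : nat) = 2)%N.
  rewrite -big_mkcondr /= sum1_card.
  have <- : #|[set 1; z]| = 2%N by rewrite cards2 eq_sym z_neq1.
  apply: eq_card => y; rewrite unfold_in !inE.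
  case: (y =P 1) => [->|_] /=; first by rewrite group1.
  by case: (y =P z) => [->|_]; rewrite ?Az ?andbF.
rewrite -[X in (_ + X)%N]count -big_split /= mulnC -sum_nat_const.
apply: eq_bigr => y _.
by case: ifP.
Qed.

(** Every distance is 2, except for x itself and its inverse x * z, where it
    drops by 2 and by 1. *)
Lemma sum_dist_out_out x : x \notin A ->
  (\sum_(y in ~: A) d x y + 3 = 2 * #|~: A|)%N.
Proof.
move=> nAx.
have xz : x * z != x by rewrite -{2}(mulg1 x) (inj_eq (mulgI x)).
have nAxz : x * z \notin A by rewrite groupMr.
rewrite (bigD1 x) ?inE //= (bigD1 (x * z)) ?inE ?nAxz //=.
rewrite !dist_out_out // eqxx (negPf xz) eqxx.
rewrite (eq_bigr (fun=> 2%N)) => [|y /andP[/andP[]]]; last first.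
  by rewrite inE => nAy yx yxz; rewrite dist_out_out // (negPf yx) (negPf yxz).
pose D := (~: A) :\ x :\ (x * z).
have -> : #|~: A| = (2 + #|D|)%N.
  by rewrite (cardsD1 x) (cardsD1 (x * z)) !inE nAx nAxz xz.
rewrite sum_nat_const (_ : #|_| = #|D|); first by lia.
by apply: eq_card => y; rewrite unfold_in !inE andbC (andbC (y \notin A)).
Qed.

Lemma sum_dist_in_out x : (\sum_(y in ~: A) d x y <= 2 * #|~: A|)%N.
Proof.
rewrite mulnC -sum_nat_const; apply: leq_sum => y _.
by rewrite power_graph_dist //; do 2?case: ifP.
Qed.
End SquareOutside.

Lemma sum_dist_injm (aT rT : finGroupType)
    (f : {morphism [set: aT]%SET >-> rT}) (A : {set rT}) :
    ('injm f)%g -> (f @* [set: aT]%SET)%g = A -> (2 < #|aT|)%N ->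
  forall x, (\sum_(y in A) graph_dist (@power_graph rT) (f x) y
             = transmission (@power_graph aT) x)%N.
Proof.
move=> injf imf aT_gt2 x.
have fI : {in [set: aT]%SET &, injective f} by apply/injmP.
rewrite -imf morphimEdom big_imset //=.
apply: eq_big => [y|y _]; first by rewrite inE.
exact: power_graph_dist_injm.
Qed.

(** * The bounds for the dicyclic group *)

Theorem theorem3p3 (R : realType) (n : nat) (hn : (2 <= n)%N)
    (Q4n C2n : finGroupType)
    (hQ : dicyclic n Q4n)
    (hC : cyclic [set: C2n]%SET) (hC2n : #|C2n| = (2 * n)%N) :
  let rho1 := distance_spectral_radius (@power_graph Q4n) R in
  let Tavg := avg_transmission (@power_graph C2n) R in
  let Tmax : R := (max_transmission (@power_graph C2n))%:R in
  2^-1 * ((Tavg + 4 * n%:R - 3)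
          + Num.sqrt ((Tavg - 4 * n%:R + 3) ^+ 2
                      + 16 * (2 * n%:R - 1) ^+ 2)) <= rho1
  /\
  rho1 <= 2^-1 * ((Tmax + 4 * n%:R - 3)
          + Num.sqrt ((Tmax - 4 * n%:R + 3) ^+ 2
                      + 32 * n%:R * (2 * n%:R - 1))).
Proof.
move=> rho1 Tavg Tmax.
have n_gt0 : (0 < n)%N by lia.
have [a [oa cardQ sqr_out]] := dicyclic_structure n_gt0 hQ.
pose A := <[a]>%G; pose z := (a ^+ n)%g.
have cardA : #|A| = (2 * n)%N by [].
have cardB : #|~: A| = (2 * n)%N by have := cardsC A; rewrite cardQ cardA; lia.
have Az : z \in A by apply: mem_cycle.
have z_neq1 : z != 1%g by rewrite -order_dvdn oa; apply/negP => /dvdn_leq; lia.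
have z2 : (z ^+ 2 = 1)%g by rewrite -expgM mulnC -oa expg_order.
have Q_gt2 : (2 < #|Q4n|)%N by lia.
have C_gt2 : (2 < #|C2n|)%N by lia.
have /isogP[f injf imf] : [set: C2n]%SET \isog A.
  by rewrite isog_cyclic_card ?cycle_cyclic // cardsT hC2n cardA eqxx.
pose d := graph_dist (@power_graph Q4n).
have d_sym x y : d x y = d y x by apply: power_graph_dist_sym.
have sumAA := sum_dist_injm injf imf C_gt2.
have sumBA x : x \notin A -> (\sum_(y in A) d x y = 4 * n - 2)%N.
  move/(sum_dist_out_in Az z_neq1 z2 sqr_out Q_gt2).
  by rewrite cardA -/d; lia.
have sumBB x : x \notin A -> (\sum_(y in ~: A) d x y = 4 * n - 3)%N.
  move/(sum_dist_out_out Az z_neq1 z2 sqr_out Q_gt2).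
  by rewrite cardB -/d; lia.
have sumAB x : (\sum_(y in ~: A) d x y <= 4 * n)%N.
  by have := sum_dist_in_out A Q_gt2 x; rewrite cardB -/d; lia.
have s_gt0 : 0 < 4 * n%:R - 2 :> R.
  have : (2 <= n%:R :> R) by rewrite ler_nat.
  by lra.
have sE : (4 * n - 2)%N%:R = 4 * n%:R - 2 :> R by rewrite natrB ?natrM //; lia.
have qE : (4 * n - 3)%N%:R = 4 * n%:R - 3 :> R by rewrite natrB ?natrM //; lia.
split.
- have -> : Tavg + 4 * n%:R - 3 = Tavg + (4 * n%:R - 3) by ring.
  have -> : (Tavg - 4 * n%:R + 3) ^+ 2 + 16 * (2 * n%:R - 1) ^+ 2
          = (Tavg - (4 * n%:R - 3)) ^+ 2 + 4 * (4 * n%:R - 2) ^+ 2 by ring.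
  apply: (two_block_lower_bound (A := A) _ _ cardA cardB) => //.
  + exact: ltn_trans Q_gt2.
  + by lia.
  + rewrite /Tavg /avg_transmission hC2n mulrCA divff ?mulr1; last first.
      by rewrite pnatr_eq0; lia.
    have fI : {in [set: C2n]%SET &, injective f} by apply/injmP.
    have AE : A = [set f u | u in [set: C2n]%SET] :> {set Q4n}.
      by rewrite -imf morphimEdom.
    transitivity (\sum_(x in [set f u | u in [set: C2n]%SET])
      \sum_(y in A) (d x y)%:R : R); first by rewrite -AE.
    rewrite big_imset //=; apply: eq_big => [u|u _]; first by rewrite inE.
    by rewrite -natr_sum sumAA.
  + rewrite (eq_bigr (fun=> 4 * n%:R - 2)) => [|x]; last first.
      by rewrite inE => nAx; rewrite -natr_sum sumBA.
    by rewrite sumr_const cardB; apply/esym/mulr_natl.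
  + rewrite (eq_bigr (fun=> 4 * n%:R - 3)) => [|x]; last first.
      by rewrite inE => nAx; rewrite -natr_sum sumBB.
    by rewrite sumr_const cardB; apply/esym/mulr_natl.
have -> : Tmax + 4 * n%:R - 3 = Tmax + (4 * n%:R - 3) by ring.
have -> : (Tmax - 4 * n%:R + 3) ^+ 2 + 32 * n%:R * (2 * n%:R - 1)
        = (Tmax - (4 * n%:R - 3)) ^+ 2 + 4 * (4 * n%:R * (4 * n%:R - 2)).
  by ring.
apply: (two_block_upper_bound (A := A)) => //.
- exact: ltn_trans Q_gt2.
- by rewrite mulr_gt0 ?ltr0n.
- move=> x Ax; have : x \in (f @* [set: C2n]%SET)%g by rewrite imf.
  case/morphimP=> u _ _ ->.
  by rewrite -natr_sum sumAA ler_nat /max_transmission; apply: leq_bigmax.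
- by move=> x _; rewrite -natr_sum -natrM ler_nat.
- by move=> x nAx; rewrite -natr_sum sumBA // sE.
- by move=> x nAx; rewrite -natr_sum sumBB // qE.
Qed.
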